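(* Let $\mathcal F$ be a good cover in $\mathbb R^d$. Then for any $(\mathcal F,r)$-family $\mathcal G$, $$h(\mathcal G)\le r(d+1).$$
   Context: A finite family $\mathcal F$ of compact sets in $\mathbb R^d$ is a good cover if for every subfamily $\mathcal F'\subset\mathcal F$ the intersection $\bigcap\mathcal F'$ is either empty or contractible. A family of sets $\mathcal G$ is an $(\mathcal F,r)$-family if for every finite $\mathcal G'\subset\mathcal G$, the intersection $\bigcap\mathcal G'$ is a union of at most $r$ pairwise disjoint sets belonging to $\mathcal F$. The Helly number $h(\mathcal G)$ of a family $\mathcal G$ is the minimal positive integer $h$ such that whenever a finite subfamily $\mathcal K\subset\mathcal G$ satisfies $\bigcap\mathcal K'\neq\emptyset$ for all $\mathcal K'\subset\mathcal K$ with $|\mathcal K'|\le h$, then $\bigcap\mathcal K\ne\emptyset$. *)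

(* Defs.v *)
From HB Require Import structures.
From mathcomp Require Import all_boot all_order all_algebra.
From mathcomp Require Import all_classical all_reals topology normedtype.
Set Implicit Arguments. Unset Strict Implicit. Unset Printing Implicit Defensive.
Import Order.TTheory GRing.Theory Num.Theory.
Import numFieldNormedType.Exports.
Local Open Scope classical_set_scope.
Local Open Scope ring_scope.

Section Defs.
Variables (R : realType) (d : nat).
Local Notation V := 'rV[R]_d.

Definition contractible (A : set V) : Prop :=
  exists (x0 : V) (H : R -> V -> V),
    A x0 /\
    {within [set p : R * V | `[0, 1]%classic p.1 /\ A p.2],
       continuous (fun p : R * V => H p.1 p.2)} /\
    (forall t x, `[0, 1]%classic t -> A x -> A (H t x)) /\
    (forall x, A x -> H 0 x = x) /\
    (forall x, A x -> H 1 x = x0).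

Definition good_cover (F : set (set V)) : Prop :=
  finite_set F /\ (forall A, F A -> compact A) /\
  forall F' : set (set V), F' `<=` F ->
    (\bigcap_(A in F') A = set0) \/ contractible (\bigcap_(A in F') A).

Definition Fr_family (F : set (set V)) (r : nat) (G : set (set V)) : Prop :=
  forall G' : set (set V), G' `<=` G -> finite_set G' -> G' !=set0 ->
    exists S : set (set V),
      S `<=` F /\ (S #<= `I_r)%card /\
      (forall A B, S A -> S B -> A <> B -> A `&` B = set0) /\
      \bigcap_(A in G') A = \bigcup_(A in S) A.

Definition helly_prop (G : set (set V)) (h : nat) : Prop :=
  forall K : set (set V), K `<=` G -> finite_set K ->
    (forall K' : set (set V), K' `<=` K -> (K' #<= `I_h)%card ->
       \bigcap_(A in K') A !=set0) ->
    \bigcap_(A in K) A !=set0.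

Definition is_helly_number (G : set (set V)) (h : nat) : Prop :=
  (0 < h)%N /\ helly_prop G h /\
  forall h' : nat, (0 < h')%N -> helly_prop G h' -> (h <= h')%N.

End Defs.

(* Main.v *)
(* Suppose n members of G have empty intersection while any proper subfamily of
   them intersects. For a nonempty proper set I of indices let A_I be the
   intersection of the members with index outside I: a disjoint union of at most
   r contractible compact sets, increasing in I; let A_[n] be a large ball.
   Consider simplices whose vertices form at most r clusters of diameter < e.
   Mod 2 cycles of such simplices in A_I bound: contract every component to a
   point, and cone the result, which is allowed because at most r points form
   at most r clusters. So there are chains c_I in A_I with boundary
   \sum_(i in I) c_(I \ i), starting from the empty simplex. Label each point x
   by some i such that x, and all points in its cell of a fine cover, avoid the
   i-th set; points of A_I get labels in I, hence by Sperner's parity argument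
   c_[n] has a simplex carrying all n labels. But the cells come from a cover
   of order d + 1, so each of its r clusters carries at most d + 1 labels, and
   n <= r(d + 1). *)
Require Import Defs.
From HB Require Import structures.
From mathcomp Require Import all_boot all_order all_algebra.
From mathcomp Require Import all_classical all_reals topology normedtype.
From mathcomp Require Import ring lra zify.
Set Implicit Arguments. Unset Strict Implicit. Unset Printing Implicit Defensive.
Import Order.TTheory GRing.Theory Num.Theory.
Import numFieldNormedType.Exports.
Local Open Scope classical_set_scope.
Local Open Scope ring_scope.

Lemma addF2 (a : 'F_2) : a + a = 0.
Proof. by rewrite -mulr2n -mulr_natl (pchar_Fp_0 (isT : prime 2)) mul0r. Qed.

(** * Chains modulo 2 *)

(* A chain is a list of simplices, known through its pairing [ev] with cochains;
   [forall phi, ev c (cobd phi) = ev c' phi] says that [c'] is the boundary of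
   [c]. The complex is augmented: a vertex has boundary [[::]]. *)
Section Chains.
Variable T : Type.
Implicit Types (c : seq (seq T)) (phi : seq T -> 'F_2).

Definition ev c phi : 'F_2 := \sum_(s <- c) phi s.

(** The faces of [x :: s'] are [s'] and [x] followed by a face of [s']; modulo 2 no signs enter. *)
Fixpoint cobd phi (s : seq T) {struct s} : 'F_2 :=
  if s is x :: s' then phi s' + cobd (phi \o cons x) s' else 0.

Lemma ev_cat c1 c2 phi : ev (c1 ++ c2) phi = ev c1 phi + ev c2 phi.
Proof. by rewrite /ev big_cat. Qed.

Lemma eq_cobd phi psi s : phi =1 psi -> cobd phi s = cobd psi s.
Proof.
elim: s phi psi => //= x s IH phi psi e; rewrite e; congr (_ + _).
by apply: IH => t; exact: e.
Qed.

Lemma cobdD phi psi s :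
  cobd (fun t => phi t + psi t) s = cobd phi s + cobd psi s.
Proof.
elim: s phi psi => [|x s IH] phi psi /=; first by rewrite addr0.
by rewrite [cobd _ s](IH (phi \o cons x) (psi \o cons x)) addrACA.
Qed.

End Chains.

Lemma cobd_map T U (f : T -> U) (phi : seq U -> 'F_2) s :
  cobd phi (map f s) = cobd (phi \o map f) s.
Proof. by elim: s phi => //= x s IH phi; rewrite IH. Qed.

Section Prism.
Variables (T : Type) (f g : T -> T).

(** The simplices [f x_0, ..., f x_i, g x_i, ..., g x_k] that triangulate the prism between the two
    images of [s]. *)
Fixpoint prism (s : seq T) : seq (seq T) :=
  if s is x :: s' then (f x :: g x :: map g s') :: map (cons (f x)) (prism s')
  else [::].

Lemma ev_prism_cons x s phi :
  ev (prism (x :: s)) phi =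
  phi (f x :: g x :: map g s) + ev (prism s) (phi \o cons (f x)).
Proof. by rewrite /ev /= big_cons big_map. Qed.

(** The chain homotopy identity, read on cochains. In the induction, applied to [phi \o cons (f x)],
    the terms [u], [v] and [phi (f x :: map g s)] each occur twice. *)
Lemma prismP s phi :
  ev (prism s) (cobd phi) + cobd (fun t => ev (prism t) phi) s =
  phi (map f s) + phi (map g s).
Proof.
elim: s phi => [|x s IH] phi; first by rewrite /ev /= big_nil !addF2.
rewrite ev_prism_cons /=.
rewrite [X in _ + (_ + X)](_ : _ =
  cobd (fun t => phi (f x :: g x :: map g t)) s +
  cobd (fun t => ev (prism t) (phi \o cons (f x))) s); last first.
  by rewrite -cobdD; apply: eq_cobd => t /=; rewrite ev_prism_cons.
rewrite cobd_map.
rewrite [ev _ (_ \o _)](_ : _ = ev (prism s) phi +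
  ev (prism s) (cobd (phi \o cons (f x)))); last by rewrite /ev -big_split.
have /= := IH (phi \o cons (f x)).
set a := ev _ (cobd _); set b := cobd (fun t => ev _ (_ \o _)) s => ab.
set u := cobd _ s; change (cobd (fun t => phi (f x :: g x :: map g t)) s) with u.
set v := ev _ phi.
transitivity (phi (g x :: map g s) + (phi (f x :: map g s)) + (u + u) + (v + v)
  + (a + b)); first ring.
rewrite !addF2 ab.
transitivity (phi (f x :: map f s) + phi (g x :: map g s) +
  (phi (f x :: map g s) + phi (f x :: map g s))); first ring.
by rewrite addF2 addr0.
Qed.

End Prism.

Lemma big_prism (T : Type) (f g : T -> T) (c : seq (seq T)) phi :
  (forall psi, ev c (cobd psi) = 0) ->
  ev (flatten (map (prism f g) c)) (cobd phi) =
  ev (map (map f) c) phi + ev (map (map g) c) phi.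
Proof.
move=> cyc; have := cyc (fun t => ev (prism f g t) phi).
rewrite /ev big_flatten /= !big_map -big_split /= => e.
rewrite -[LHS]addr0 -[X in _ + X]e -big_split /=.
by apply: eq_bigr => s _; exact: prismP.
Qed.

(** * Sperner's parity count *)

Section Sperner.
Variable T : eqType.

Lemma cobd_symE (phi : seq T -> 'F_2) s :
  (forall s t, perm_eq s t -> phi s = phi t) ->
  cobd phi s = \sum_(y <- s) phi (rem y s).
Proof.
elim: s phi => [|x s IH] phi sym /=; first by rewrite big_nil.
rewrite big_cons /= eqxx; congr (_ + _).
rewrite IH; last by move=> u v uv /=; apply: sym; rewrite perm_cons.
rewrite !big_seq; apply: eq_bigr => y ys /=.
case: eqVneq => [->|//]; apply: sym.
by rewrite perm_sym perm_to_rem.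
Qed.

Lemma perm_eq_rem (a s : seq T) y : y \in s ->
  perm_eq (rem y s) a = perm_eq s (y :: a).
Proof. by move=> /perm_to_rem/permPl ->; rewrite perm_cons. Qed.

(** A list [s] has one face labelled by [a] if it is a permutation of [i :: a]; two, which cancel,
    if it is [a] with one entry doubled; otherwise none. *)
Lemma cobd_perm (a s : seq T) i : uniq (i :: a) -> {subset s <= i :: a} ->
  cobd (fun t => (perm_eq t a)%:R) s = (perm_eq s (i :: a))%:R.
Proof.
move=> /andP[ia ua] sia; rewrite cobd_symE; last first.
  by move=> u v /permPl uv; rewrite uv.
rewrite big_seq (eq_bigr (fun y => (perm_eq s (y :: a))%:R)); last first.
  by move=> y ys; rewrite perm_eq_rem.
rewrite -big_seq.
have sumE y0 : perm_eq s (y0 :: a) ->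
    \sum_(y <- s) (perm_eq s (y :: a))%:R = (count_mem y0 s)%:R :> 'F_2.
  move=> sy0; rewrite -sum1_count natr_sum [RHS]big_mkcond /=.
  apply: eq_bigr => y _; rewrite (permPl sy0) /=.
  case: eqVneq => [->|yy0]; first by rewrite perm_refl.
  case: (boolP (perm_eq _ _)) => // /permP/(_ (pred1 y)) /=.
  by rewrite eqxx eq_sym (negPf yy0) => /eqP; rewrite eqn_add2r.
case: (boolP (perm_eq s (i :: a))) => [si|nsi].
  rewrite (sumE i si) (permP si) /= eqxx.
  by move: ia; rewrite -has_pred1 has_count -eqn0Ngt => /eqP ->.
case: (boolP (has (fun y => perm_eq s (y :: a)) s)) => [/hasP[y ys sy]|/hasPn no].
  rewrite (sumE y sy) (permP sy) /= eqxx.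
  have : y \in i :: a by exact: sia.
  rewrite inE => /predU1P[yi|ya]; first by rewrite yi (negPf nsi) in sy.
  by rewrite count_uniq_mem // ya natrD addF2.
by rewrite big_seq big1 // => y /no/negPf ->.
Qed.
End Sperner.

(** * Small cycles bound *)

Section Filling.
Variables (R : realType) (V : pseudoMetricType R).
Implicit Types (A : set V) (c : seq (seq V)).

(* [s] splits into at most [r] clusters of size [e]: a discrete point of the
   r-fold join of [A] with itself. *)
Definition small r (e : R) A (s : seq V) :=
  (forall x, x \in s -> A x) /\
  exists B : 'I_r -> set V,
    (forall a x y, B a x -> B a y -> ball x e y) /\
    (forall x, x \in s -> exists a, B a x).

(* A discrete deformation of [A] within itself onto at most [r] points. *)
Definition shrinkable r A := forall e : R, 0 < e -> exists2 dl : R, 0 < dl &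
  exists (N : nat) (h : nat -> V -> V) (p : 'I_r -> V),
  [/\ forall x, A x -> h 0%N x = x,
      forall j x, A x -> A (h j x),
      forall j x y, A x -> A y -> ball x dl y ->
        ball (h j x) e (h j y) /\ ball (h j x) e (h j.+1 y)
    & forall j x, (N <= j)%N -> A x -> exists a, h j x = p a].

Lemma sub_small r (e e' : R) A A' s :
  e <= e' -> A `<=` A' -> small r e A s -> small r e' A' s.
Proof.
move=> ee' AA' [As [B [Be Bs]]]; split; first by move=> x /As/AA'.
exists B; split=> // a x y Bx By; exact: le_ball (Be _ _ _ Bx By).
Qed.

Lemma mem_prism (f g : V -> V) s t y : t \in prism f g s -> y \in t ->
  exists2 x, x \in s & y = f x \/ y = g x.
Proof.
elim: s t => //= x s IH t; rewrite inE => /predU1P[->|/mapP[u us ->]].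
  rewrite !inE => /or3P[/eqP->|/eqP->|/mapP[z zs ->]].
  - by exists x; [rewrite mem_head|left].
  - by exists x; [rewrite mem_head|right].
  - by exists z; [rewrite inE zs orbT|right].
rewrite inE => /predU1P[->|yu]; first by exists x; [rewrite mem_head|left].
by have [z zs zE] := IH u us yu; exists z; rewrite // inE zs orbT.
Qed.

Lemma filling r A : A !=set0 -> shrinkable r A ->
  forall e : R, 0 < e -> exists2 dl : R, 0 < dl & forall c,
    (forall s, s \in c -> small r dl A s) ->
    (forall phi, ev c (cobd phi) = 0) ->
    exists2 c', (forall s, s \in c' -> small r e A s) &
      forall phi, ev c' (cobd phi) = ev c phi.
Proof.
move=> [x0 Ax0] shA e e0.
have [dl dl0 [N [h [p [h0 hA hb hN]]]]] := shA e e0.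
exists dl => // c csm ccyc.
have [c1 c1sm c1E] : exists2 c1, (forall s, s \in c1 -> small r e A s) &
    forall phi, ev c1 (cobd phi) = ev c phi + ev (map (map (h N)) c) phi.
  elim: {hN}N => [|N [c1 c1sm c1E]].
    exists [::] => // phi; rewrite {1}/ev big_nil.
    rewrite [X in _ + X](_ : _ = ev c phi) ?addF2//.
    rewrite /ev big_map big_seq [RHS]big_seq; apply: eq_bigr => s sc.
    congr phi; rewrite -[RHS]map_id; apply/eq_in_map => x xs.
    by apply: h0; have [+ _] := csm _ sc; exact.
  exists (c1 ++ flatten (map (prism (h N) (h N.+1)) c)) => [t|phi].
    rewrite mem_cat => /orP[/c1sm//|/flatten_mapP[s sc ts]].
    have [sA [B [Bdl Bs]]] := csm _ sc; split=> [y yt|].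
      by have [x /sA Ax [->|->]] := mem_prism ts yt; exact: hA.
    (* A cluster of the prism unites both images of one cluster of [s], so [r] clusters still
       suffice. [A x] is demanded because [B a] may leave [A]. *)
    exists (fun a => [set y | exists x, [/\ B a x, A x &
      y = h N x \/ y = h N.+1 x]]); split=> [a y z|y yt].
      move=> [u [Bu Au uE]] [v [Bv Av vE]].
      have [b1 b2] := hb N u v Au Av (Bdl _ _ _ Bu Bv).
      have [b3 _] := hb N.+1 u v Au Av (Bdl _ _ _ Bu Bv).
      have [_ b4] := hb N v u Av Au (Bdl _ _ _ Bv Bu).
      by case: uE => ->; case: vE => ->//; exact: ball_sym.
    have [x xs xE] := mem_prism ts yt; have [a Ba] := Bs x xs.
    by exists a, x; split=> //; exact: sA.
  rewrite ev_cat c1E big_prism// -addrA; congr (_ + _).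
  by rewrite addrA addF2 add0r.
(* The cone is small: its vertices are among the [r] points [p a]. *)
exists (c1 ++ map (fun s => h N x0 :: map (h N) s) c) => [t|phi].
  rewrite mem_cat => /orP[/c1sm//|/mapP[s sc ->]].
  have [sA _] := csm _ sc; split=> [y|].
    by rewrite inE => /predU1P[->|/mapP[x /sA Ax ->]]; exact: hA.
  exists (fun a => [set p a]); split=> [a x y -> ->|y]; first exact: ballxx.
  rewrite inE => /predU1P[->|/mapP[x /sA Ax ->]].
    exact: (hN N x0 (leqnn N) Ax0).
  exact: (hN N x (leqnn N) Ax).
rewrite ev_cat c1E -addrA -[RHS]addr0; congr (_ + _).
have -> : ev (map (fun s => h N x0 :: map (h N) s) c) (cobd phi) =
    ev (map (map (h N)) c) phi +
    ev c (cobd (phi \o cons (h N x0) \o map (h N))).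
  rewrite /ev !big_map -big_split; apply: eq_bigr => s _ /=.
  by rewrite cobd_map.
by rewrite ccyc addr0 addF2.
Qed.

End Filling.

Lemma uniform_pos (R : realType) (I : finType) (P : I -> R -> Prop) :
  (forall i e e', 0 < e' -> e' <= e -> P i e -> P i e') ->
  (forall i, exists2 e, 0 < e & P i e) -> exists2 e, 0 < e & forall i, P i e.
Proof.
move=> mono ex.
suff [e e0 eP] : exists2 e : R, 0 < e & forall i, i \in enum I -> P i e.
  by exists e => // i; apply: eP; rewrite mem_enum.
elim: (enum I) => [|i s [e e0 eP]]; first by exists 1.
have [e' e'0 e'P] := ex i.
have m0 : 0 < Num.min e e' by rewrite lt_min e0.
exists (Num.min e e') => // j; rewrite inE => /predU1P[->|/eP].
  by apply: mono e'P; rewrite // ge_min lexx orbT.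
by apply: mono; rewrite // ge_min lexx.
Qed.

(** * Chains carried by the sets [A I] *)

Section Sperner_chains.
Variables (R : realType) (V : pseudoMetricType R) (n r : nat).
Variable A : {set 'I_n} -> set V.
Hypothesis A_mono : forall I J : {set 'I_n}, I \subset J -> A I `<=` A J.
Hypothesis A_neq0 : forall I, I != finset.set0 -> A I !=set0.
Hypothesis A_shrinkable : forall I, I != finset.set0 -> shrinkable r (A I).

(** Each unordered pair is counted twice. This makes the sum of the chains of the sets [I :\ i] a
    cycle. *)
Lemma sum_offdiag (I : {set 'I_n}) (F : 'I_n -> 'I_n -> 'F_2) :
  (forall i j, F i j = F j i) ->
  \sum_(i in I) \sum_(j in I :\ i) F i j = 0.
Proof.
move=> symF.
have -> : \sum_(i in I) \sum_(j in I :\ i) F i j =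
    \sum_(i in I) \sum_(j in I | (i < j)%N) F i j +
    \sum_(i in I) \sum_(j in I | (j < i)%N) F i j.
  rewrite -big_split; apply: eq_bigr => i iI.
  rewrite (bigID (fun j : 'I_n => (i < j)%N)) /=; congr (_ + _).
    apply: eq_bigl => j; rewrite !inE; case: (ltnP i j); rewrite ?andbF//.
    by move=> ij; rewrite !andbT (_ : j != i)//; apply: contraTneq ij => ->;
      rewrite ltnn.
  by apply: eq_bigl => j; rewrite !inE -leqNgt ltn_neqAle -andbA andbCA.
rewrite [X in _ + X](exchange_big_dep (mem I)) /=; last by move=> i j _ /andP[].
rewrite -big_split big1// => i iI /=.
rewrite [X in _ + X](_ : _ = \sum_(j in I | (i < j)%N) F i j) ?addF2//.
apply: eq_big => [j|j _]; last exact: symF.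
by rewrite iI.
Qed.

(** Induction on the cardinality: the chains of the sets [I :\ i] add up to a cycle, which [filling]
    bounds in [A I]. The scale [e] varies in the induction, because the chains of smaller index sets
    must already have the finer size that [filling] asks for. *)
Lemma carrier_chains (m : nat) (e : R) : 0 < e ->
  exists c : {set 'I_n} -> seq (seq V), c finset.set0 = [:: [::]] /\
    forall I : {set 'I_n}, (#|I| <= m)%N ->
      (forall s, s \in c I -> small r e (A I) s) /\
      (forall phi, ev (c I) (cobd phi) = \sum_(i in I) ev (c (I :\ i)) phi).
Proof.
elim: m e => [|m IH] e e0.
  exists (fun=> [:: [::]]); split=> // I; rewrite leqn0 cards_eq0 => /eqP ->.
  split=> [s|phi]; last by rewrite big_set0 /ev big_seq1.
  rewrite inE => /eqP ->; split=> //.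
  by exists (fun=> set0); split.
have [dl dl0 fill] : exists2 dl : R, 0 < dl & forall I : {set 'I_n},
    I != finset.set0 -> forall c, (forall s, s \in c -> small r dl (A I) s) ->
    (forall phi, ev c (cobd phi) = 0) ->
    exists2 c', (forall s, s \in c' -> small r e (A I) s) &
      forall phi, ev c' (cobd phi) = ev c phi.
  apply: uniform_pos => [I d d' _ d'd H I0 c cs|I].
    by apply: H => // s /cs; exact: sub_small.
  have [->|I0] := eqVneq I finset.set0; first by exists 1; rewrite ?eqxx.
  have [d d0 dP] := filling (A_neq0 I0) (A_shrinkable I0) e0.
  by exists d.
have e1 : 0 < Num.min e dl by rewrite lt_min e0.
have [c [c0 cP]] := IH _ e1.
have step (I : {set 'I_n}) : exists cI : seq (seq V), #|I| = m.+1 ->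
    (forall s, s \in cI -> small r e (A I) s) /\
    (forall phi, ev cI (cobd phi) = \sum_(i in I) ev (c (I :\ i)) phi).
  have [Im|] := eqVneq #|I| m.+1; last first.
    by move=> /negPf Im; exists [::] => /eqP; rewrite Im.
  have I0 : I != finset.set0 by rewrite -card_gt0 Im.
  have Ii i : i \in I -> (#|I :\ i| <= m)%N.
    by move=> iI; rewrite -ltnS -Im (cardsD1 i I) iI.
  have evI phi : ev (flatten [seq c (I :\ i) | i <- enum I]) phi =
      \sum_(i in I) ev (c (I :\ i)) phi.
    by rewrite /ev big_flatten big_map big_enum.
  have [|phi|c' c's c'E] := fill I I0 (flatten [seq c (I :\ i) | i <- enum I]).
  - move=> s /flatten_mapP[i]; rewrite mem_enum => iI sc.
    have [/(_ s sc) + _] := cP _ (Ii _ iI).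
    by apply: sub_small; [rewrite ge_min lexx orbT|apply/A_mono/subsetDl].
  - rewrite evI.
    transitivity (\sum_(i in I) \sum_(j in I :\ i) ev (c (I :\ i :\ j)) phi).
      by apply: eq_bigr => i iI; have [_] := cP _ (Ii _ iI); exact.
    by apply: sum_offdiag => i j; rewrite !finset.setDDl finset.setUC.
  by exists c' => _; split=> // phi; rewrite c'E evI.
have [c' c'P] := choice step.
exists (fun I : {set 'I_n} => if #|I| == m.+1 then c' I else c I).
rewrite cards0; split=> //.
move=> I; rewrite leq_eqVlt => /predU1P[Im|].
  have [sm bd] := c'P I Im; rewrite Im eqxx; split=> // phi.
  rewrite bd; apply: eq_bigr => i iI; rewrite ifF//.
  by move: Im; rewrite (cardsD1 i I) iI add1n => -[->]; rewrite ltn_eqF.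
rewrite ltnS => Im; have [sm bd] := cP I Im.
rewrite ifF; last by rewrite ltn_eqF.
split=> [s /sm|phi]; first by apply: sub_small => //; rewrite ge_min lexx.
rewrite bd; apply: eq_bigr => i iI; rewrite ifF//.
by rewrite ltn_eqF// ltnS (leq_trans (subset_leq_card (subsetDl _ _))).
Qed.

(** By induction on [#|I|], an odd number of simplices of [c I] carry every element of [I] exactly
    once as a label; the empty simplex starts the count. *)
Lemma rainbow_simplex (e : R) (l : V -> 'I_n) : 0 < e ->
  (forall I x, A I x -> l x \in I) ->
  exists2 s, small r e (A finset.setT) s &
    forall i, exists2 x, x \in s & l x = i.
Proof.
move=> e0 lA; have [c [c0 cP]] := carrier_chains n e0.
have cP' I := cP I (leq_trans (max_card _) (eq_leq (card_ord n))).
have sub I s : s \in c I -> {subset map l s <= I}.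
  move=> sc i /mapP[x xs ->]; apply: lA.
  by have [/(_ s sc)[+ _] _] := cP' I; exact.
have odd_rainbow k (I : {set 'I_n}) : #|I| = k ->
    ev (c I) (fun s => (perm_eq (map l s) (enum I))%:R) = 1.
  elim: k I => [|k IH] I.
    move=> /eqP; rewrite cards_eq0 => /eqP ->.
    by rewrite c0 /ev big_seq1 /= enum_set0.
  move=> Ik; have /set0Pn[i iI] : I != finset.set0 by rewrite -card_gt0 Ik.
  have Ik' : #|I :\ i| = k by move: Ik; rewrite (cardsD1 i I) iI add1n => -[].
  apply: etrans (IH _ Ik').
  set psi := fun s => (perm_eq (map l s) (enum (I :\ i)))%:R.
  have [_ /(_ psi)] := cP' I.
  (* A simplex of [c (I :\ j)] never has the label [j], so for [psi] only the term [c (I :\ i)] of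
     the boundary counts. *)
  rewrite (big_setD1 i)//= [X in _ + X]big1 ?addr0 => [<-|j].
    rewrite /ev big_seq [RHS]big_seq; apply: eq_bigr => s sc.
    have perI : perm_eq (enum I) (i :: enum (I :\ i)).
      apply: uniq_perm => [||j]; rewrite ?enum_uniq//=.
        by rewrite mem_enum !inE eqxx enum_uniq.
      rewrite inE !mem_enum !inE; case: eqVneq => [->|//]; exact: iI.
    rewrite /= (permPr perI) -cobd_perm.
    - rewrite -[psi]/((fun t => (perm_eq t (enum (I :\ i)))%:R) \o map l).
      by rewrite cobd_map.
    - by rewrite -(perm_uniq perI) enum_uniq.
    - by move=> x /(sub _ _ sc) xI; rewrite -(perm_mem perI) mem_enum.
  rewrite !inE => /andP[ji jI]; rewrite /ev big_seq big1// => s sc.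
  rewrite /psi; case: (boolP (perm_eq _ _)) => // /perm_mem /(_ j).
  rewrite mem_enum !inE ji jI => /(sub _ _ sc).
  by rewrite !inE eqxx.
have : ev (c finset.setT)
    (fun s => (perm_eq (map l s) (enum (finset.setT : {set 'I_n})))%:R) != 0.
  by rewrite (odd_rainbow n) ?oner_eq0// cardsT card_ord.
case: (boolP (has (fun s => perm_eq (map l s)
    (enum (finset.setT : {set 'I_n}))) (c finset.setT))).
  move=> /hasP[s sc sl] _; exists s.
    by have [/(_ s sc)] := cP' finset.setT.
  move=> i; have /mapP[x xs ->] : i \in map l s.
    by rewrite (perm_mem sl) mem_enum inE.
  by exists x.
by move=> /hasPn no; rewrite /ev big_seq big1 ?eqxx// => s /no/negPf ->.
Qed.

End Sperner_chains.

(** * Compact sets in Euclidean space *)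

(** Each point of [K i0] keeps a positive distance from some [K i], and compactness makes this
    distance uniform. *)
Lemma compact_separation (R : realType) (V : pseudoMetricType R) (I : finType)
    (i0 : I) (K : I -> set V) :
  compact (K i0) -> (forall i, closed (K i)) -> \bigcap_i K i = set0 ->
  exists2 e : R, 0 < e &
    forall x : I -> V, (forall i, K i (x i)) -> ~ forall i j, ball (x i) e (x j).
Proof.
move=> cK clK K0.
have cover : \forall e \near 0^'+, K i0 `<=`
    [set x | exists i, forall y, K i y -> ~ ball x e y].
  apply: (iffLR (compact_near_coveringP (K i0)) cK R 0^'+
    (fun e x => exists i, forall y, K i y -> ~ ball x e y)) => x _.
  have [i nKx] : exists i, ~ K i x.
    apply: contrapT => /forallNP nK.
    suff : set0 x by [].
    by rewrite -K0 => i _; exact: contrapT.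
  have : nbhs x (~` K i) by apply: open_nbhs_nbhs; split=> //; exact: closed_openC.
  move=> /nbhs_ballP[/= e e0 eK].
  near=> z e'; have e'e : e' <= e / 2.
    by near: e'; apply: nbhs_right_le; rewrite divr_gt0.
  exists i => y Ky zy; apply: (eK y) => //.
  rewrite (splitr e); apply: (@ball_triangle _ _ z).
    by near: z; apply: nbhsx_ballx; rewrite divr_gt0.
  exact: le_ball zy.
have [e [e0 eP]] : exists e : R, 0 < e /\ K i0 `<=`
    [set x | exists i, forall y, K i y -> ~ ball x e y].
  near (0:R)^'+ => e; exists e; split=> //; near: e; exact: cover.
exists e => // x Kx xe; have [i /(_ _ (Kx i))] := eP _ (Kx i0).
by apply; exact: xe.
Unshelve. all: by end_near. Qed.

(** Heine-Cantor relative to a subset, as a contraction is continuous only within [[0, 1]] times the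
    set. *)
Lemma compact_unif_continuous (R : realType) (U V : pseudoMetricType R)
    (C : set U) (f : U -> V) :
  compact C -> {within C, continuous f} -> forall e : R, 0 < e ->
  exists2 dl : R, 0 < dl &
    forall x y, C x -> C y -> ball x dl y -> ball (f x) e (f y).
Proof.
move=> cC /subspace_continuousP cf e e0.
have cover : \forall dl \near 0^'+, C `<=`
    [set x | forall y, C y -> ball x dl y -> ball (f x) e (f y)].
  have /near_covering_withinP nC := iffLR (compact_near_coveringP C) cC.
  apply: (nC R 0^'+
    (fun dl x => forall y, C y -> ball x dl y -> ball (f x) e (f y))) => x Cx.
  have e20 : 0 < e / 2 by rewrite divr_gt0.
  have := cvg_ball (cf x Cx) e20.
  rewrite near_withinE => /(_ (within_filter _ _)) /nbhs_ballP[/= d d0 dP].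
  near=> z dl; have dld : dl <= d / 2.
    by near: dl; apply: nbhs_right_le; rewrite divr_gt0.
  move=> Cz y Cy zy; rewrite (splitr e); apply: (@ball_triangle _ _ (f x)).
    apply/ball_sym/dP => //; apply: le_ball (_ : ball x (d / 2) z).
      by rewrite ler_pdivrMr// ler_pMr// ler1n.
    by near: z; apply: nbhsx_ballx; rewrite divr_gt0.
  apply: dP => //; rewrite /= (splitr d); apply: (@ball_triangle _ _ z).
    by near: z; apply: nbhsx_ballx; rewrite divr_gt0.
  exact: le_ball zy.
near (0:R)^'+ => dl; exists dl => //.
move=> x y Cx.
suff: C `<=` [set x | forall y, C y -> ball x dl y -> ball (f x) e (f y)].
  by move/(_ x Cx); exact.
by near: dl; exact: cover.
Unshelve. all: by end_near. Qed.

Lemma shrinkable_leq (R : realType) (V : pseudoMetricType R) r (A : set V) :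
  (0 < r)%N -> shrinkable 1 A -> shrinkable r A.
Proof.
move=> r0 sA e /sA [dl dl0 [N [h [p [h0 hA hb hN]]]]].
exists dl => //; exists N, h, (fun=> p ord0); split=> // j x Nj Ax.
exists (Ordinal r0); have [a ->] := hN j x Nj Ax.
by rewrite ord1.
Qed.

(** The contraction is sampled at the times [j / N], with [N] so large that consecutive times lie
    within the modulus of uniform continuity. *)
Lemma contractible_shrinkable (R : realType) d (A : set 'rV[R]_d) :
  compact A -> contractible A -> shrinkable 1 A.
Proof.
move=> cA [x0 [H [Ax0 [cH [HA [H0 H1]]]]]] e e0.
have cK : compact (`[0, 1]%classic `*` A : set (R * 'rV[R]_d)).
  by apply: compact_setX => //; exact: segment_compact.
have [dl dl0 uH] := compact_unif_continuous cK cH e0.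
pose N := (Num.truncn dl^-1).+1.
have N0 : 0 < N%:R :> R by rewrite ltr0n.
have Ndl : N%:R^-1 < dl by rewrite invf_plt ?posrE//; exact: truncnS_gt.
(* Capped at 1, so that from stage [N] on every map is constant on [A]. *)
pose t (j : nat) : R := Num.min 1 (j%:R / N%:R).
have t01 j : `[0, 1]%classic (t j).
  by rewrite /= in_itv /= le_min ler01 divr_ge0//= ge_min lexx.
have tS j : ball (t j) dl (t j.+1).
  rewrite /ball /= ltr_norml /t.
  have -> : j.+1%:R / N%:R = j%:R / N%:R + N%:R^-1 :> R.
    by rewrite -addn1 natrD mulrDl mul1r.
  have : 0 < N%:R^-1 :> R by rewrite invr_gt0.
  by rewrite /Num.min; do 2 case: ifP; lra.
exists dl => //; exists N, (fun j => H (t j)), (fun=> x0); split.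
- by move=> x Ax; rewrite /t mul0r min_r ?ler01// H0.
- by move=> j x Ax; exact: HA.
- move=> j x y Ax Ay xy; split.
    apply: (uH (t j, x) (t j, y)); split=> //; try exact: t01.
    exact: ballxx.
  by apply: (uH (t j, x) (t j.+1, y)); split=> //; first [exact: t01|exact: tS].
- move=> j x Nj Ax; exists ord0; rewrite /t min_l ?H1//.
  by rewrite ler_pdivlMr// mul1r ler_nat.
Qed.

(** Disjoint compact pieces have positive distance, so close points share a piece and each piece can
    be shrunk independently to its own point. *)
Lemma shrinkable_disjoint_union (R : realType) d r (C : 'I_r -> set 'rV[R]_d) :
  (forall a, compact (C a)) -> (forall a b, a != b -> C a `&` C b = set0) ->
  (forall a, shrinkable 1 (C a)) -> shrinkable r (\bigcup_a C a).
Proof.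
move=> cC dC sC e e0.
have clC a : closed (C a) by apply: compact_closed => //; exact: norm_hausdorff.
have hex a : exists dl : R, 0 < dl /\
    exists (Nhp : nat * (nat -> 'rV[R]_d -> 'rV[R]_d) * 'rV[R]_d),
    [/\ forall x, C a x -> Nhp.1.2 0%N x = x,
      forall j x, C a x -> C a (Nhp.1.2 j x),
      forall j x y, C a x -> C a y -> ball x dl y ->
        ball (Nhp.1.2 j x) e (Nhp.1.2 j y) /\
        ball (Nhp.1.2 j x) e (Nhp.1.2 j.+1 y)
    & forall j x, (Nhp.1.1 <= j)%N -> C a x -> Nhp.1.2 j x = Nhp.2].
  have [dl dl0 [N [h [p [h0 hA hb hN]]]]] := sC a e e0.
  exists dl; split=> //; exists (N, h, p ord0); split=> //= j x Nj Cx.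
  by have [b ->] := hN j x Nj Cx; rewrite ord1.
have [dl hdl] := choice hex.
have [Nhp hP] := choice (fun a => (hdl a).2).
have [d1 d10 d1P] : exists2 d1 : R, 0 < d1 & forall a, d1 <= dl a.
  apply: uniform_pos => [a s s' _ s's|a]; first exact: le_trans.
  by exists (dl a) => //; exact: (hdl a).1.
have [d2 d20 d2P] : exists2 d2 : R, 0 < d2 & forall ab : 'I_r * 'I_r,
    ab.1 != ab.2 -> forall x y, C ab.1 x -> C ab.2 y -> ~ ball x d2 y.
  apply: uniform_pos => [[a b] s s' _ s's + ab x y Cx Cy xy|[a b]] /=.
    by move/(_ ab x y Cx Cy); apply; exact: le_ball xy.
  have [->|ab] := eqVneq a b; first by exists 1.
  have [|i||s s0 sP] :=
      @compact_separation _ _ bool true (fun i => if i then C a else C b).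
  - exact: cC.
  - by case: i.
  - rewrite -subset0 => x Cx; rewrite -(dC a b ab); split.
      exact: (Cx true).
    exact: (Cx false).
  exists s => // _ x y Cx Cy xy.
  apply: (sP (fun i => if i then x else y)) => [[]//|[] []] //=; try exact: ballxx.
  exact: ball_sym.
pose h j x := if [pick a | `[< C a x >]] is Some a then (Nhp a).1.2 j x else x.
have hE a j x : C a x -> h j x = (Nhp a).1.2 j x.
  move=> Cx; rewrite /h; case: pickP => [b /asboolP Cbx|/(_ a)/asboolP//].
  have [->//|ba] := eqVneq b a.
  by have : set0 x by rewrite -(dC b a ba).
have m0 : 0 < Num.min d1 d2 by rewrite lt_min d10.
exists (Num.min d1 d2) => //.
exists (\max_a (Nhp a).1.1)%N, h, (fun a => (Nhp a).2); split.
- by move=> x [a _ Cx]; rewrite (hE a)//; have [+ _ _ _] := hP a; exact.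
- move=> j x [a _ Cx]; exists a => //; rewrite (hE a)//.
  by have [_ + _ _] := hP a; exact.
- move=> j x y [a _ Cx] [b _ Cy] xy.
  have ab : a = b.
    apply/eqP/negP => /negP ab; apply: (d2P (a, b) ab x y) => //.
    by apply: le_ball xy; rewrite ge_min lexx orbT.
  rewrite -ab in Cy; rewrite !(hE a)//; have [_ _ + _] := hP a; apply=> //.
  by apply: le_ball xy; rewrite ge_min d1P.
- move=> j x Nj [a _ Cx]; exists a; rewrite (hE a)//.
  have [_ _ _ +] := hP a; apply=> //; apply: leq_trans Nj.
  exact: (leq_bigmax (F := fun a => (Nhp a).1.1)).
Qed.

(** Straight-line contraction to 0. The ball will carry the chain of the full index set, where the
    intersection over no index would be the whole space. *)
Lemma shrinkable_ball (R : realType) d (M : R) : 0 <= M ->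
  shrinkable 1 [set x : 'rV[R]_d | `|x| <= M].
Proof.
move=> M0; apply: contractible_shrinkable.
  apply: bounded_closed_compact.
    exists M; split; rewrite ?num_real// => y My x /= xM.
    by apply: (le_trans xM); exact: ltW.
  rewrite (_ : [set x | _] =
    (fun x : 'rV[R]_d => `|x|) @^-1` [set t : R | t <= M])//.
  by apply: preimage_closed => [x _|]; [exact: norm_continuous|exact: closed_le].
exists 0, (fun t x => (1 - t) *: x); split; first by rewrite /= normr0.
split.
  apply: continuous_subspaceT => p.
  apply: (@cvgZ _ _ _ _ _ (fun p : R * 'rV[R]_d => 1 - p.1) snd) => //.
    apply: cvgB; [exact: cvg_cst|exact: cvg_fst].
  exact: cvg_snd.
split=> [t x|].
  rewrite /= in_itv /= => /andP[t0 t1] xM; rewrite normrZ.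
  apply: le_trans xM; rewrite ler_piMl// ger0_norm; lra.
by split=> x _; rewrite ?subr0 ?scale1r// subrr scale0r.
Qed.

Lemma compact_bigcup_fin (X : topologicalType) (I : finType) (C : I -> set X) :
  (forall i, compact (C i)) -> compact (\bigcup_i C i).
Proof.
move=> cC; rewrite (_ : \bigcup_i C i = \big[setU/set0]_(i in predT) C i).
  exact: bigsetU_compact.
rewrite -bigcup_pred; congr bigcup.
by apply/seteqP; split.
Qed.

(* Each coordinate [y j] rules out at most one of the [d + 1] shifts. *)
Lemma frac_away (R : realType) d (y : 'I_d -> R) : exists k : 'I_d.+1,
  forall j (z : int),
    (2 * d.+1%:R)^-1 <= `|y j - k%:R / d.+1%:R - z%:~R|.
Proof.
apply: contrapT => /forallNP bad.
have bad' (k : 'I_d.+1) : exists jz : 'I_d * int,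
    `|y jz.1 - k%:R / d.+1%:R - jz.2%:~R| < (2 * d.+1%:R)^-1.
  have /existsNP[j /existsNP[z /negP]] := bad k.
  by rewrite -ltNge => ?; exists (j, z).
have [f fP] := choice bad'.
(* Pigeonhole: [d + 1] shifts, [d] coordinates. Two shifts that fail at the same coordinate would be
   congruent modulo [d + 1]. *)
have /injectivePn[k [k' kk' jkk']] : ~~ injectiveb (fun k => (f k).1).
  by apply/negP => /injectiveP/leq_card; rewrite !card_ord ltnn.
have := fP k; have := fP k'; rewrite jkk'.
set a := y _; set z := (f k).2; set z' := (f k').2 => h1 h2.
have D0 : 0 < d.+1%:R :> R by rewrite ltr0n.
have Dn0 : d.+1%:R != 0 :> R by rewrite gt_eqF.
have small1 : `|k%:R - k'%:R + d.+1%:R * (z%:~R - z'%:~R)| < 1 :> R.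
  rewrite (_ : k%:R - k'%:R + _ = d.+1%:R * ((a - k'%:R / d.+1%:R - z'%:~R)
    - (a - k%:R / d.+1%:R - z%:~R))); last first.
    by move: (d.+1%:R : R) Dn0 => D Dn0; field.
  rewrite normrM gtr0_norm// mulrC -ltr_pdivlMr// mul1r.
  rewrite (le_lt_trans (ler_normB _ _))//.
  rewrite [ltRHS](_ : _ = (2 * d.+1%:R)^-1 + (2 * d.+1%:R)^-1); last first.
    by move: (d.+1%:R : R) Dn0 => D Dn0; field.
  exact: ltrD.
have : `|k%:Z - k'%:Z + d.+1%:Z * (z - z')| < 1.
  by rewrite -(ltr_int R) intr_norm intrD intrM !intrB.
move: (ltn_ord k) (ltn_ord k') (kk' : (k : nat) != k').
move: (nat_of_ord k) (nat_of_ord k') => m m' md m'd mm' h.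
have {}h : m%:Z - m'%:Z + d.+1%:Z * (z - z') = 0 by lia.
have [zz|[zz|zz]] : z - z' = 0 \/ z - z' >= 1 \/ z - z' <= -1 by lia.
- by rewrite zz mulr0 in h; lia.
- by nia.
- by nia.
Qed.

(* Lebesgue's covering theorem: the cells [c k = v] with [k] fixed are
   separated, so a small set meets at most [d + 1] of the chosen cells. *)
Lemma covering_dimension (R : realType) d (eta : R) : 0 < eta ->
  exists2 e : R, 0 < e &
  exists (c : 'I_d.+1 -> 'rV[R]_d -> 'rV[int]_d) (k : 'rV[R]_d -> 'I_d.+1),
    (forall x y, ball x e y -> c (k x) y = c (k x) x) /\
    (forall x y, c (k x) x = c (k y) y -> ball x eta y).
Proof.
(* The 2 leaves one unit for the floor and one for the shifts, which may differ between [x] and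
   [y]. *)
move=> eta0; pose N : R := (Num.truncn (2 / eta)).+1%:R.
have N0 : 0 < N by rewrite ltr0n.
have Neta : 2 < N * eta by rewrite -ltr_pdivrMr//; exact: truncnS_gt.
have D0 : 0 < d.+1%:R :> R by rewrite ltr0n.
pose tau : R := (2 * d.+1%:R)^-1.
have tau0 : 0 < tau by rewrite invr_gt0 mulr_gt0.
pose c (k : 'I_d.+1) (x : 'rV[R]_d) : 'rV[int]_d :=
  \row_j Num.floor (N * x 0 j - k%:R / d.+1%:R).
have [k kP] := choice (fun x : 'rV[R]_d => frac_away (fun j => N * x 0 j)).
(* With the shift [k x] subtracted, [N * x 0 j] is at least [tau] away from every integer, so a move
   of less than [tau] keeps its floor. *)
exists (tau / N); first exact: divr_gt0.
exists c, k; split=> x y.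
  move=> [_ xy]; apply/rowP => j; rewrite !mxE; apply: floor_def.
  set b := k x : nat; have := kP x j; rewrite -/b -/tau => kx.
  set z := Num.floor _.
  have := kx z; have := kx (z + 1).
  have := floor_itv (N * x 0 j - b%:R / d.+1%:R); rewrite -/z.
  have : `|N * x 0 j - N * y 0 j| < tau.
    rewrite -mulrBr normrM gtr0_norm// mulrC -ltr_pdivlMr//; exact: xy.
  rewrite !intrD ltr_norml !ler_normr; move: (z%:~R : R) (b%:R / _) => u v.
  by move=> /andP[? ?] /andP[? ?] /orP[?|?] /orP[?|?]; lra.
move=> cxy; split=> // i j; rewrite ord1 {i}.
have /rowP/(_ j) := cxy; rewrite !mxE => fxy.
have := floor_itv (N * x 0 j - (k x)%:R / d.+1%:R).
have := floor_itv (N * y 0 j - (k y)%:R / d.+1%:R).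
rewrite fxy intrD; move: (_%:~R) => z.
have k01 (u : 'I_d.+1) : 0 <= u%:R / d.+1%:R :> R /\ u%:R / d.+1%:R < 1 :> R.
  by rewrite divr_ge0//; split=> //; rewrite ltr_pdivrMr// mul1r ltr_nat.
move: (k01 (k x)) (k01 (k y)) => [+ +] [+ +].
move: (_ / _) (_ / _) => u v u0 u1 v0 v1 h1 h2.
have : `|N * (x 0 j - y 0 j)| < N * eta.
  by rewrite (lt_trans _ Neta)// ltr_norml; lra.
by rewrite normrM gtr0_norm// ltr_pM2l.
Qed.

(** * Helly numbers *)

Section Helly_bound.
Variables (R : realType) (d n r : nat) (g : 'I_n -> set 'rV[R]_d).
Local Notation V := 'rV[R]_d.
Hypotheses (r0 : (0 < r)%N) (gc : forall i, compact (g i)).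
Hypothesis g0 : \bigcap_i g i = set0.
Hypothesis gI : forall I : {set 'I_n}, I != finset.set0 ->
  \bigcap_(i in [set i | i \notin I]) g i !=set0.
Hypothesis gS : forall I : {set 'I_n}, I != finset.setT ->
  shrinkable r (\bigcap_(i in [set i | i \notin I]) g i).

Lemma critical_family_card : (n <= r * d.+1)%N.
Proof.
case: (posnP n) => [->//|n0]; pose i0 := Ordinal n0.
have gcl i : closed (g i) by apply: compact_closed => //; exact: norm_hausdorff.
have [eta eta0 etaP] := compact_separation (@gc i0) gcl g0.
have [e e0 [c [k [ck1 ck2]]]] := @covering_dimension R d eta eta0.
have [M [M0 gM]] : exists M : R, 0 <= M /\
    forall i x, g i x -> `|x| <= M.
  have [M [_ MP]] := compact_bounded (compact_bigcup_fin gc).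
  exists (`|M| + 1); split=> [|i x gx]; first by rewrite addr_ge0.
  apply: (MP (`|M| + 1)); last by exists i.
  by rewrite (le_lt_trans (ler_norm M))// ltrDl.
(* Points of one cell are [eta]-close by [ck2], hence cannot be taken one from each [g i]. *)
have lamE v : exists i, forall x, c (k x) x = v -> ~ g i x.
  apply: contrapT => /forallNP H.
  have H' i : exists x, g i x /\ c (k x) x = v.
    by have /existsNP[x /not_implyP[xv /contrapT gx]] := H i; exists x.
  have [x xP] := choice H'; apply: (etaP x) => [i|i j]; first by have [] := xP i.
  by apply: ck2; rewrite (xP i).2 (xP j).2.
have [lam lamP] := choice lamE.
pose A (I : {set 'I_n}) : set V := if I == finset.setT then [set x | `|x| <= M]
  else \bigcap_(i in [set i | i \notin I]) g i.
have A_mono (I J : {set 'I_n}) : I \subset J -> A I `<=` A J.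
  move=> IJ x; rewrite /A; case: (eqVneq J finset.setT) => [_|JT].
    case: eqVneq => // IT Ax.
    have /set0Pn[i iI] : ~: I != finset.set0.
      by apply: contraNneq IT => I0; rewrite -[I]finset.setCK I0 finset.setC0.
    by apply: (gM i); apply: Ax; rewrite /= -finset.in_setC.
  rewrite ifF => [Ax i /= iJ|]; last first.
    by apply: contraNF JT => /eqP IT; rewrite -finset.subTset -IT.
  by apply: Ax => /=; apply: contraNN iJ; exact: (fintype.subsetP IJ).
have A_neq0 I : I != finset.set0 -> A I !=set0.
  rewrite /A; case: (eqVneq I finset.setT) => [_ _|_]; last exact: gI.
  by exists 0; rewrite /= normr0.
have A_shr I : I != finset.set0 -> shrinkable r (A I).
  rewrite /A; case: (eqVneq I finset.setT) => [_ _|IT _]; last exact: gS.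
  by apply: shrinkable_leq => //; exact: shrinkable_ball.
have [I x AIx|s [_ [B [Be Bs]]] sl] :=
    rainbow_simplex A_mono A_neq0 A_shr (l := fun x => lam (c (k x) x)) e0.
  (* A label names a set that the point avoids, whereas a point of [A I], for [I] not full, lies in
     [g i] for all [i] outside [I]. *)
  apply/negP => /negP lI; move: AIx; rewrite /A ifF => [Ax|].
    by apply: (lamP (c (k x) x) x erefl); exact: Ax.
  by apply: contraNF lI => /eqP ->; rewrite inE.
(* A label depends only on the cluster and the shift: [xget] picks a representative of the cluster,
   and by [ck1] it has the same value of [c (k x)] as any [x] in that cluster. *)
pose psi (ak : 'I_r * 'I_d.+1) := lam (c ak.2 (xget 0 (B ak.1))).
have psi_surj i : exists ak, psi ak = i.
  have [x xs <-] := sl i; have [a Bax] := Bs x xs.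
  exists (a, k x); rewrite /psi /=; congr lam; apply: ck1.
  by apply: (Be a) => //; exact: (xgetPex 0 (ex_intro _ x Bax)).
have [phi phiK] := choice psi_surj.
have /leq_card : injective phi by exact: can_inj phiK.
by rewrite card_prod !card_ord.
Qed.

End Helly_bound.

Section Unions.
Variables (R : realType) (d r : nat) (F G : set (set 'rV[R]_d)).
Hypotheses (r0 : (0 < r)%N) (goodF : good_cover F) (FrG : Fr_family F r G).

(** The pieces of the intersection are members of [F], each empty or contractible as the
    intersection of a one-member subfamily. An injection into [I_r] numbers them; a number not taken
    gives an empty piece, which shrinks vacuously. *)
Lemma Fr_family_shrinkable (G' : set (set 'rV[R]_d)) :
  G' `<=` G -> finite_set G' -> G' !=set0 ->
  compact (\bigcap_(A in G') A) /\ shrinkable r (\bigcap_(A in G') A).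
Proof.
move=> G'G G'fin G'0; have [finF [Fc Fcontr]] := goodF.
have [S [SF [Sr [Sdisj ->]]]] := FrG G'G G'fin G'0.
have /injfunPex[f fS finj] : $|{injfun S >-> `I_r}| by exact/pcard_leP.
pose C (a : 'I_r) := \bigcup_(A in [set A | S A /\ f A = a]) A.
have -> : \bigcup_(A in S) A = \bigcup_a C a.
  apply/seteqP; split=> x [].
    by move=> A SA Ax; exists (Ordinal (fS A SA)) => //; exists A.
  by move=> a _ [A [SA _] Ax]; exists A.
have CE a : C a = set0 \/ S (C a).
  have [[A [SA fA]]|no] := pselect (exists A, S A /\ f A = a).
    right; rewrite (_ : C a = A)//; apply/seteqP; split=> [x [B [SB fB] Bx]|x Ax].
      by rewrite -(finj _ _ _ _ (etrans fB (esym fA))) ?inE.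
    by exists A.
  by left; rewrite -subset0 => x [A SA _]; apply: no; exists A.
have cC a : compact (C a).
  by case: (CE a) => [->|/SF/Fc//]; exact: compact0.
split; first exact: compact_bigcup_fin.
apply: shrinkable_disjoint_union => // [a b ab|a].
  rewrite -subset0 => x [[A [SA fA] Ax] [B [SB fB] Bx]].
  rewrite -(Sdisj A B)// => AB; move: ab.
  by rewrite -val_eqE /= -fA -fB AB eqxx.
have [C0|contrC] : C a = set0 \/ contractible (C a).
  case: (CE a) => [|SC]; first by left.
  by rewrite -[C a](bigcap_set1 id); apply: Fcontr => _ ->; exact: SF.
  rewrite C0 => e e0; exists 1 => //.
  by exists 0%N, (fun _ => id), (fun=> 0); split.
exact: contractible_shrinkable.
Qed.

(** A least number [n] of members of [K] with empty intersection gives a critical family, so [n] is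
    at most [r * d.+1], and the hypothesis on small subfamilies contradicts the choice of these
    members. *)
Lemma Fr_family_helly : helly_prop G (r * d.+1).
Proof.
move=> K KG Kfin Kr; apply: contrapT => /set0P/negP/negPn/eqP K0.
pose crit n := `[< exists g : 'I_n -> set 'rV[R]_d,
  (forall i, K (g i)) /\ \bigcap_i g i = set0 >].
have ex_crit : exists n, crit n.
  have /finite_seqP[s sE] := Kfin.
  exists (size s); apply/asboolP; exists (tnth (in_tuple s)).
  split=> [i|]; first by rewrite sE; exact: mem_tnth.
  rewrite -subset0 -K0 => x sx A; rewrite sE => /= As.
  by have /tnthP[i ->] : A \in in_tuple s by []; exact: sx.
case: (ex_minnP ex_crit) => n /asboolP[g [gK g0]] nmin.
have fin_img (D : set 'I_n) : finite_set (g @` D) by exact: finite_image.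
have imgE (D : set 'I_n) : \bigcap_(i in D) g i = \bigcap_(A in g @` D) A.
  by rewrite bigcap_image.
have shr (D : set 'I_n) : D !=set0 ->
    compact (\bigcap_(i in D) g i) /\ shrinkable r (\bigcap_(i in D) g i).
  move=> [i Di]; rewrite imgE; apply: Fr_family_shrinkable => //.
    by move=> _ [j _ <-]; exact/KG/gK.
  by exists (g i), i.
have nr : (n <= r * d.+1)%N.
  apply: (critical_family_card (g := g)) => // [i|I I0|I IT].
  - have [+ _] := shr [set i] (ex_intro _ i erefl); by rewrite bigcap_set1.
  - apply/set0P/negP => /eqP gI0.
    (* The members with index outside the nonempty [I] are fewer than [n], so by minimality they
       intersect. *)
    have : (n <= #|~: I|)%N.
      apply: nmin; apply/asboolP; exists (fun j => g (enum_val j)); split=> //.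
      rewrite -subset0 -gI0 => x gx i /= iI.
      have iC : i \in ~: I by rewrite inE.
      by have := gx (enum_rank_in iC i) Logic.I; rewrite enum_rankK_in.
    have cI := cardsC I; rewrite card_ord in cI.
    rewrite leqNgt => /negP; apply; rewrite -(ltn_add2l #|I|) cI.
    by rewrite -[ltnLHS]add0n ltn_add2r card_gt0.
  - have [|//] := shr [set i | i \notin I].
    apply: contrapT => /set0P/negP/negPn/eqP I0.
    case/negP: IT; apply/eqP/setP => i; rewrite inE; apply: contrapT => iI.
    have : set0 i by rewrite -I0; exact/negP.
    by [].
have n0 : (0 < n)%N.
  rewrite lt0n; apply/eqP => nE; have : set0 (0 : 'rV[R]_d).
    by rewrite -g0 => i _; have := ltn_ord i; rewrite [X in (_ < X)%N]nE.
  by [].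
(* [g] is extended to all naturals by the default index 0, so that its image is bounded in
   cardinality by [I_n]. *)
pose G0 m := g (insubd (Ordinal n0) m).
have [||x xG0] := Kr (G0 @` `I_n).
- by move=> _ [m _ <-]; exact: gK.
- apply: card_le_trans (card_image_le _ _) _; by rewrite card_le_II.
have : set0 x.
  rewrite -g0 => i _; apply: (xG0 (g i)); exists (val i); first exact: (ltn_ord i).
  by rewrite /G0 valKd.
by [].
Qed.

End Unions.

Theorem theorem1p3 (R : realType) (d r : nat) (F G : set (set 'rV[R]_d)) :
  (0 < r)%N -> good_cover F -> Fr_family F r G ->
  exists h : nat, is_helly_number G h /\ (h <= r * d.+1)%N.
Proof.
move=> r0 goodF FrG.
pose P h := `[< (0 < h)%N /\ helly_prop G h >].
have Pr : P (r * d.+1)%N.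
  apply/asboolP; split; first by rewrite muln_gt0 r0.
  exact: Fr_family_helly goodF FrG.
case: (ex_minnP (ex_intro P _ Pr)) => h /asboolP[h0 hP] hmin.
exists h; split; last exact: hmin.
by split=> //; split=> // h' h'0 h'P; apply/hmin/asboolP.
Qed.
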